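(* For every integer $n\geq 7$, $I'(P_{n})=I''(P_{n})=\lfloor\frac{n}{2}\rfloor+1$, where $P_n$ is the path with $n$ vertices.
   Context: For a finite simple undirected graph $H$ with vertex set $V(H)$ and $v\in V(H)$, $B_H(v)=\{u\in V(H): d_H(u,v)\leq 1\}$, where $d_H$ is the distance in $H$. A code is a nonempty set of vertices. A code $C$ separates two distinct vertices $x,y$ if $B_H(x)\cap C\neq B_H(y)\cap C$. $I'(H)$ denotes the minimum cardinality of a code $C'\subseteq V(H)$ that separates every pair of distinct vertices of $H$. $I''(H)$ denotes the minimum cardinality of a code $C''\subseteq V(H)$ that separates every pair of distinct vertices of $H$ and satisfies $C''\not\subseteq B_H(v)$ for every $v\in V(H)$. The path $P_n$ of order $n$ has vertex set $\{0,1,\ldots,n-1\}$ and edges $\{i,i+1\}$ for $i=0,\ldots,n-2$. *)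

(* Defs.v *)
From mathcomp Require Import all_boot.

Set Implicit Arguments.
Unset Strict Implicit.
Unset Printing Implicit Defensive.

Record sgraph := SGraph {
  vertex :> finType;
  adj : rel vertex;
  adj_sym : symmetric adj;
  adj_irrefl : irreflexive adj
}.

Definition has_walk (G : sgraph) (u v : G) (k : nat) : bool :=
  [exists p : k.-tuple G, path (@adj G) u p && (last u p == v)].

(* [find] returns the least k < #|G| such that there is a walk of length k.
   Finite distances are always < #|G|, so the value #|G|, returned when there
   is no such k, encodes an infinite distance; it is at least 2 whenever two
   distinct vertices exist. *)
Definition dist (G : sgraph) (u v : G) : nat :=
  find (has_walk u v) (iota 0 #|G|).

Definition ball (G : sgraph) (v : G) : {set G} := [set u | dist u v <= 1].

Definition separates (G : sgraph) (C : {set G}) (x y : G) : bool :=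
  ball x :&: C != ball y :&: C.

Definition separating (G : sgraph) (C : {set G}) : bool :=
  (C != set0) && [forall x : G, forall y : G, (x != y) ==> separates C x y].

Definition separating_spread (G : sgraph) (C : {set G}) : bool :=
  separating C && [forall v : G, ~~ (C \subset ball v)].

(* [None] when no set satisfies P: in general graphs (for instance with two
   vertices having the same closed neighbourhood) there may be no such code. *)
Definition min_card (T : finType) (P : pred {set T}) : option nat :=
  omap (fun C : {set T} => #|C|)
       [pick C | P C && [forall D : {set T}, P D ==> (#|C| <= #|D|)]].

(* I'(G) *)
Definition Iprime (G : sgraph) : option nat := min_card (@separating G).

(* I''(G) *)
Definition Isecond (G : sgraph) : option nat := min_card (@separating_spread G).

Definition path_adj (n : nat) : rel 'I_n :=
  fun i j => (i.+1 == j :> nat) || (j.+1 == i :> nat).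

Lemma path_adj_sym (n : nat) : symmetric (@path_adj n).
Proof. by move=> i j; rewrite /path_adj orbC. Qed.

Lemma path_adj_irrefl (n : nat) : irreflexive (@path_adj n).
Proof. by move=> i; rewrite /path_adj orbb eqn_leq ltnn. Qed.

Definition path_graph (n : nat) : sgraph :=
  SGraph (@path_adj_sym n) (@path_adj_irrefl n).

(* Main.v *)
Require Import Defs.
From mathcomp Require Import all_boot.
From mathcomp Require Import zify.

Set Implicit Arguments.
Unset Strict Implicit.
Unset Printing Implicit Defensive.

(** Write [c] for the indicator function of a code [C] of the path on [n]
    vertices.  The balls of [j+1] and [j+2] differ exactly in [j] and [j+3], so
    a separating code contains [j] or [j+3] whenever [j+3 < n]; at the two ends
    the same comparison forces [2] and [n-3] into the code.  Moreover at most
    one vertex is undominated, that is, has a ball disjoint from [C].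

    Lower bound.  Summing [c j + c (j+3) >= 1] over all [j < n-3] counts every
    vertex twice, except the first three and the last three, which are counted
    once ([double_count]).  Hence
      2|C| >= (n-3) + c 0 + c 1 + c 2 + c (n-3) + c (n-2) + c (n-1).
    Here [c 2 = c (n-3) = 1], and one of [0], [n-1] is dominated, so one of the
    remaining four terms is [1]: [2|C| >= n].  For odd [n] this is the bound.
    For even [n] equality has to be excluded ([code_lower_bound]): it would
    make every summand exactly [1], so [c (j+3) = ~~ c j] throughout
    ([double_count_tight]), and [c] would be determined by its first three
    values.  The end conditions then fail unless [6] divides [n]; in that case
    the code is, in every block of six, either [{2,3,4}], which leaves [0] and
    [6] undominated, or [{1,2,3}], which leaves [5] and [11] undominated.  These
    vertices exist because [n >= 12]; for [n = 6] the code [{2,3,4}] is indeed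
    separating.

    Upper bound.  The even vertices together with [n-3] form a separating code
    ([parity_code_separating]).

    Finally, a separating code has at least four elements by the lower bound
    and a ball has at most three, so the spread condition is automatic and the
    two minima are taken over the same family of codes. *)

(** * Balls, separation and minimum cardinality *)

Lemma has_walk0 (G : sgraph) (u v : G) : has_walk u v 0 = (u == v).
Proof.
apply/existsP/eqP => [[p]|->].
  by rewrite (tuple0 p) /= => /eqP.
by exists [tuple]; rewrite /= eqxx.
Qed.

Lemma has_walk1 (G : sgraph) (u v : G) : has_walk u v 1 = adj u v.
Proof.
apply/existsP/idP => [[p]|uv].
  by case/tupleP: p => x p; rewrite (tuple0 p) /= andbT => /andP[ux /eqP <-].
by exists [tuple v]; rewrite /= uv eqxx.
Qed.

Lemma dist_le1 (G : sgraph) (u v : G) :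
  (dist u v <= 1) = (u == v) || adj u v.
Proof.
rewrite /dist; case cardG: #|G| => [|[|k]] /=.
- by have := max_card (pred1 u); rewrite cardG card1.
- (* a one-vertex graph: [find] is at most 1 whatever the predicate *)
  have -> : u = v by apply: (fintype_le1P _); rewrite cardG.
  by rewrite eqxx; case: ifP.
- by rewrite has_walk0 has_walk1; case: eqP => //=; case: (adj u v).
Qed.

(** Balls of a path in terms of numbers, where linear arithmetic decides
    membership. *)
Definition near (i j : nat) : bool := (i <= j.+1) && (j <= i.+1).

Lemma in_path_ball (n : nat) (x z : path_graph n) :
  (z \in ball x) = near (x : 'I_n) (z : 'I_n).
Proof.
rewrite inE dist_le1 /= /path_adj /near -(inj_eq val_inj) /=.
by apply/idP/idP; lia.
Qed.

Lemma card_path_ball (n : nat) (x : path_graph n) : #|ball x| <= 3.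
Proof.
rewrite cardE -(size_map val) -(size_iota (x : 'I_n).-1 3).
apply: uniq_leq_size; first by rewrite (map_inj_uniq val_inj) enum_uniq.
move=> _ /mapP[z + ->]; rewrite mem_enum in_path_ball /near mem_iota /=; lia.
Qed.

Lemma separatesP (G : sgraph) (C : {set G}) (x y : G) :
  reflect (exists2 z, z \in C & (z \in ball x) != (z \in ball y))
          (separates C x y).
Proof.
apply: (iffP idP) => [|[z zC]]; last first.
  apply: contraNN => /eqP/setP/(_ z); rewrite !in_setI zC !andbT => ->.
  by [].
move=> sep; apply/exists_inP; apply: contraNT sep => /exists_inPn same.
apply/eqP/setP => z; rewrite !in_setI.
by case zC: (z \in C); rewrite ?andbF ?andbT //; apply/eqP/negPn/same.
Qed.

Lemma separatingP (G : sgraph) (C : {set G}) :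
  separating C ->
  forall x y, x != y ->
    exists2 z, z \in C & (z \in ball x) != (z \in ball y).
Proof.
by case/andP=> _ /forallP sep x y xy; apply/separatesP;
   have /forallP/(_ y)/implyP/(_ xy) := sep x.
Qed.

Lemma min_cardE (T : finType) (P : pred {set T}) (C : {set T}) :
  P C -> (forall D, P D -> #|C| <= #|D|) -> min_card P = Some #|C|.
Proof.
move=> PC minC; rewrite /min_card; case: pickP => [D /andP[PD /forallP minD]|].
  by congr Some; apply/eqP; rewrite eqn_leq minC // (implyP (minD C)).
by move/(_ C); rewrite PC => /forallP[D]; apply/implyP/minC.
Qed.

(** * The lower bound *)

Lemma sum_recr3 (F : nat -> nat) (L : nat) :
  \sum_(0 <= i < L.+1 + 3) F i = \sum_(0 <= i < L + 3) F i + F (L + 3).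
Proof. by rewrite [L.+1 + 3]addSn big_nat_recr. Qed.

(** The pairs [{j, j+3}] with [j < L] cover each position twice, less once for
    being among the first three and less once for being among the last three;
    each pair contributes at least [1] to the sum. *)
Lemma double_count (c : nat -> bool) (L : nat) :
  (forall j, j < L -> c j || c (j + 3)) ->
  L + (c 0 + c 1 + c 2 + (c L + c L.+1 + c L.+2))
    <= 2 * \sum_(0 <= i < L + 3) c i.
Proof.
elim: L => [_|L IH cover]; first by rewrite !big_nat_recr ?big_geq //=; lia.
have {IH} := IH (fun j jL => cover j (ltnW jL)); have := cover L (ltnSn L).
by rewrite sum_recr3 -[L.+3]addn3; lia.
Qed.

(** Every pair contributes at least [1], so equality in [double_count] makes
    every pair contribute exactly [1]. *)
Lemma double_count_tight (c : nat -> bool) (L : nat) :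
  (forall j, j < L -> c j || c (j + 3)) ->
  2 * \sum_(0 <= i < L + 3) c i
    <= L + (c 0 + c 1 + c 2 + (c L + c L.+1 + c L.+2)) ->
  forall j, j < L -> c (j + 3) = ~~ c j.
Proof.
elim: L => [//|L IH cover tight j].
have coverL j' (jL : j' < L) := cover j' (ltnW jL).
have := double_count coverL; have := cover L (ltnSn L).
move: tight; rewrite sum_recr3 -[L.+3]addn3 => tight cL count.
rewrite ltnS leq_eqVlt => /orP[/eqP->|]; first by lia.
by apply: IH => //; lia.
Qed.

Lemma period6_of_antiperiod3 (c : nat -> bool) (n : nat) :
  (forall j, j < n - 3 -> c (j + 3) = ~~ c j) ->
  forall k r, r + 6 * k < n -> c (r + 6 * k) = c r.
Proof.
move=> anti; elim=> [r _|k IH r lt_n]; first by rewrite muln0 addn0.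
have -> : r + 6 * k.+1 = r + 6 * k + 3 + 3 by lia.
by rewrite !anti ?negbK ?IH //; lia.
Qed.

(** By antiperiodicity [c] is determined by [c 0], [c 1] and [c 2 = true], so
    the end conditions become conditions on these.  With [n] even there are three
    residues of [n] modulo [6].  Residue [2] puts [n-3] in the class of [5],
    where [c] is [false]; residue [4] makes both [c 1] and [c (n-2)] true, one
    too many; residue [0] forces [c 0 = false], and whatever [c 1] is, two
    vertices of the first two blocks of six are undominated. *)
Lemma tight_code_absurd (c : nat -> bool) (n : nat) : 7 <= n -> ~~ odd n ->
  (forall i, n <= i -> c i = false) ->
  c 2 -> c (n - 3) ->
  (forall j, j < n - 3 -> c (j + 3) = ~~ c j) ->
  (forall u v, u < n -> v < n -> u != v ->
     [|| c u.-1, c u, c u.+1, c v.-1, c v | c v.+1]) ->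
  c 0 + c 1 + (c (n - 2) + c (n - 1)) <= 1 ->
  False.
Proof.
move=> n7 + out first last anti dominated one_end.
have period := period6_of_antiperiod3 anti.
have n4 : 3 < n - 3 by clear -n7; lia.
have c3 : c 3 = ~~ c 0 by apply: (anti 0); apply: ltn_trans n4.
have c4 : c 4 = ~~ c 1 by apply: (anti 1); apply: ltn_trans n4.
have c5 : c 5 = false by rewrite (anti 2) ?first //; apply: ltn_trans n4.
have r6 : n %% 6 < 6 by rewrite ltn_mod.
move: (divn_eq n 6) r6; set q := n %/ 6; set r := n %% 6.
move=> n_div r6 n_even; clearbody q r.
case: r r6 n_div => [|[|[|[|[|[|r]]]]]] // _ n_div.
- have n12 : 12 <= n by clear -n_div n7; lia.
  have n3 : n - 3 = 3 + 6 * q.-1 by clear -n_div n12; lia.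
  have c0 : c 0 = false.
    move: last; rewrite n3 period ?c3; first by case: (c 0).
    by clear -n3 n7; lia.
  have c6 : c 6 = false by rewrite -c0; apply: (period 1 0); apply: leq_trans n12.
  have c7 : c 7 = c 1 by apply: (period 1 1); apply: leq_trans n12.
  have c10 : c 10 = ~~ c 1 by rewrite -c4; apply: (period 1 4); apply: leq_trans n12.
  have c11 : c 11 = false by rewrite -c5; apply: (period 1 5); apply: leq_trans n12.
  have c12 : c 12 = false.
    have [/out //|lt12] := leqP n 12.
    by rewrite -c0; apply: (period 2 0).
  have lt_n k : k < 12 -> k < n by move=> /leq_trans; apply.
  have [c1|c1] := boolP (c 1).
  + have := dominated 5 11 (lt_n 5 isT) (lt_n 11 isT) isT.
    by rewrite [5.-1]/= [11.-1]/= c4 c5 c6 c10 c11 c12 c1.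
  + have := dominated 0 6 (lt_n 0 isT) (lt_n 6 isT) isT.
    by rewrite [0.-1]/= [6.-1]/= c0 c5 c6 c7 (negPf c1).
- by clear -n_even n_div; lia.
- have n3 : n - 3 = 5 + 6 * q.-1 by clear -n_div n7; lia.
  by move: last; rewrite n3 period ?c5 //; clear -n3 n7; lia.
- by clear -n_even n_div; lia.
- have n3 : n - 3 = 1 + 6 * q by clear -n_div; lia.
  have n2 : n - 2 = 2 + 6 * q by clear -n_div; lia.
  move: last one_end; rewrite n3 n2 !period; try by clear -n3 n2 n7; lia.
  by move=> ->; rewrite first; case: (c 0).
- by clear -n_even n_div; lia.
Qed.

(** The code is an indicator function on all numbers, vanishing beyond the path,
    so that the balls at the ends of the path need no separate treatment. *)
Lemma code_lower_bound (c : nat -> bool) (n : nat) : 7 <= n ->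
  (forall i, n <= i -> c i = false) ->
  (forall i j, i < n -> j < n -> i != j ->
     exists2 k, c k & near i k != near j k) ->
  n < 2 * \sum_(0 <= i < n) c i.
Proof.
move=> n7 out sep.
have c_lt k : c k -> k < n.
  by move=> ck; rewrite ltnNge; apply/negP => /out; rewrite ck.
have first : c 2.
  have [k ck] : exists2 k, c k & near 0 k != near 1 k by apply: sep; lia.
  by rewrite /near => d; have -> : 2 = k by lia.
have last : c (n - 3).
  have [k ck] : exists2 k, c k & near (n - 2) k != near (n - 1) k.
    by apply: sep; lia.
  by rewrite /near => d; have := c_lt k ck => kn; have -> : n - 3 = k by lia.
have cover j : j < n - 3 -> c j || c (j + 3).
  move=> jn; have [k ck] : exists2 k, c k & near j.+1 k != near j.+2 k.
    by apply: sep; lia.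
  rewrite /near => d; have [<-|<-] : k = j \/ k = j + 3 by lia.
  - by rewrite ck.
  - by rewrite ck orbT.
(* [u.-1] lies in the ball of [u] also for [u = 0], where it is [0]. *)
have dominated u v : u < n -> v < n -> u != v ->
    [|| c u.-1, c u, c u.+1, c v.-1, c v | c v.+1].
  move=> un vn uv; have [k ck] := sep u v un vn uv; rewrite /near => d.
  have [<-|[<-|[<-|[<-|[<-|<-]]]]] : k = u.-1 \/ k = u \/ k = u.+1 \/
                                     k = v.-1 \/ k = v \/ k = v.+1 by lia.
  1-6: by rewrite ck ?orbT.
have ends : [|| c 0, c 1, c (n - 2) | c (n - 1)].
  have := dominated 0 (n - 1); rewrite [0.-1]/= [c (n - 1).+1]out; last by lia.
  have -> : (n - 1).-1 = n - 2 by lia.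
  by lia.
have count := double_count cover.
have tight := double_count_tight cover.
rewrite subnK in count tight; last by lia.
have last2 : (n - 3).+1 = n - 2 by lia.
have last1 : (n - 2).+1 = n - 1 by lia.
rewrite last2 last1 in count tight.
rewrite ltnNge; apply/negP => small.
have {}tight j : j < n - 3 -> c (j + 3) = ~~ c j by apply: tight; lia.
have n_even : ~~ odd n by lia.
(* Equality leaves room for just one of the four vertices in [ends]. *)
have one_end : c 0 + c 1 + (c (n - 2) + c (n - 1)) <= 1 by lia.
exact: tight_code_absurd n7 n_even out first last tight dominated one_end.
Qed.

Lemma separating_lower_bound (n : nat) (C : {set path_graph n}) :
  7 <= n -> separating C -> n %/ 2 + 1 <= #|C|.
Proof.
move=> n7 sepC.
pose c i := [exists x in C, (x : 'I_n) == i :> nat].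
have cE (x : 'I_n) : c x = (x \in (C : {set 'I_n})).
  apply/exists_inP/idP => [[y yC /eqP yx]|xC]; last by exists x.
  by rewrite (_ : x = y) //; apply: val_inj.
have -> : #|C| = \sum_(0 <= i < n) c i.
  by rewrite big_mkord -sum1_card big_mkcond /=; apply: eq_bigr => x _; rewrite cE.
suff : n < 2 * \sum_(0 <= i < n) c i by lia.
apply: code_lower_bound => // [i ni|i j ilt jlt ij].
  by apply/exists_inP => -[x _ /eqP xi]; have := ltn_ord (x : 'I_n); lia.
have xy : (Ordinal ilt : path_graph n) != Ordinal jlt by [].
have [z zC] := separatingP sepC xy.
by rewrite !in_path_ball => d; exists (z : 'I_n); first by rewrite cE.
Qed.

(** A code of at least [4] elements does not fit in a ball, which has at most
    [3]. *)
Lemma separating_is_spread (n : nat) (C : {set path_graph n}) :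
  7 <= n -> separating C -> separating_spread C.
Proof.
move=> n7 sepC; rewrite /separating_spread sepC; apply/forallP => v.
apply/negP => /subset_leq_card; have := card_path_ball v.
by have := separating_lower_bound n7 sepC; lia.
Qed.

(** * An optimal code *)

(** Even vertices dominate everything and separate all pairs except [n-2], [n-1]
    when [n] is even; for odd [n] the extra vertex [n-3] is already even. *)
Definition parity_code (n : nat) : {set path_graph n} :=
  [set x : 'I_n | ~~ odd x || (x == n - 3 :> nat)].

Lemma card_parity_code (n : nat) : 3 <= n -> #|parity_code n| = n %/ 2 + 1.
Proof.
move=> n3; pose p i := ~~ odd i || (i == n - 3).
have -> : #|parity_code n| = \sum_(0 <= i < n) p i.
  rewrite big_mkord -sum1_card big_mkcond /=.
  by apply: eq_bigr => x _; rewrite inE.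
(* Counting prefixes: the extra vertex contributes only if n-3 is odd. *)
have prefix k : \sum_(0 <= i < k) p i = uphalf k + (~~ odd n && (n - 3 < k)).
  elim: k => [|k IH]; first by rewrite big_nil ltn0 andbF.
  by rewrite big_nat_recr //= IH /p; lia.
by rewrite prefix; lia.
Qed.

Lemma parity_code_separating (n : nat) : 4 <= n -> separating (parity_code n).
Proof.
move=> n4.
have witness (x y : 'I_n) : x < y -> separates (parity_code n) x y.
  move=> xy; have yn := ltn_ord y.
  have [k kn /andP[kC kxy]] :
      exists2 k, k < n & (~~ odd k || (k == n - 3)) && (near x k != near y k).
    rewrite /near; have [/eqP yx|yx] := boolP (y == x.+1 :> nat); last first.
      by exists (x - odd x); lia.
    have [x0|x0] := boolP (x == 0 :> nat); first by exists 2; lia.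
    have [xe|xe] := boolP (odd x || (x == n - 2 :> nat)).
      by exists x.-1; lia.
    by exists x.+2; lia.
  apply/separatesP; exists (Ordinal kn : path_graph n); first by rewrite inE.
  by rewrite !in_path_ball.
apply/andP; split.
  have n0 : 0 < n by lia.
  by apply/set0Pn; exists (Ordinal n0); rewrite inE.
apply/forallP => x; apply/forallP => y; apply/implyP.
rewrite -(inj_eq val_inj) neq_ltn => /orP[/witness //|/witness].
by rewrite /separates eq_sym.
Qed.

Theorem proposition2p3 (n : nat) (hn : 7 <= n) :
  Iprime (path_graph n) = Isecond (path_graph n) /\
  Isecond (path_graph n) = Some (n %/ 2 + 1).
Proof.
have sepC : separating (parity_code n) by apply: parity_code_separating; lia.
rewrite -card_parity_code; last by lia.
have minC (D : {set path_graph n}) :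
    separating D -> #|parity_code n| <= #|D|.
  by move=> sepD; rewrite card_parity_code; [exact: separating_lower_bound hn sepD|lia].
have second : Isecond (path_graph n) = Some #|parity_code n|.
  apply: min_cardE; first exact: separating_is_spread.
  by move=> D /andP[/minC].
by split=> //; rewrite second; apply: min_cardE.
Qed.
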